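(* Let $(\mathcal{M},g,\overset{1}{\nabla})$ be an $n$-dimensional ($n\ge 3$) GRW space-time with a semi-symmetric metric $P$-connection, $P$ unit timelike. Then the curvature tensors $\overset{0}{R}$, $\overset{4}{R}$ and $\overset{5}{R}$ are non-zero.
   Context: Setting: $(\mathcal{M},g)$ is a Lorentzian manifold of signature $(-,+,\dots,+)$ with Levi-Civita connection $\overset{g}{\nabla}$; $P$ is a vector field with $g(P,P)=-1$, and $\pi(\cdot)=g(\cdot,P)$. The connection $\overset{1}{\nabla}_XY=\overset{g}{\nabla}_XY+\pi(Y)X-g(X,Y)P$ is a semi-symmetric metric $P$-connection, i.e. $\overset{1}{\nabla}P=0$; equivalently $\overset{g}{\nabla}_XP=X+\pi(X)P$ for all $X$. Such a manifold is a generalized Robertson-Walker (GRW) space-time (locally a warped product with metric $-(\mathrm dt)^2+f(t)^2g^*$, $g^*$ Riemannian). Associated connections: the mutual connection $\overset{2}{\nabla}_XY=\overset{1}{\nabla}_YX+[X,Y]$, that is $\overset{2}{\nabla}_XY=\overset{g}{\nabla}_XY+\pi(X)Y-g(X,Y)P$, and the symmetric connection $\overset{0}{\nabla}_XY=\frac12(\overset{1}{\nabla}_XY+\overset{2}{\nabla}_XY)$. Curvature tensors used: $\overset{0}{R}(X,Y)Z=\overset{0}{\nabla}_X\overset{0}{\nabla}_YZ-\overset{0}{\nabla}_Y\overset{0}{\nabla}_XZ-\overset{0}{\nabla}_{[X,Y]}Z$; $\overset{4}{R}(X,Y)Z=\overset{2}{\nabla}_X\overset{1}{\nabla}_YZ-\overset{1}{\nabla}_Y\overset{2}{\nabla}_XZ+\overset{2}{\nabla}_{\overset{2}{\nabla}_YX}Z-\overset{1}{\nabla}_{\overset{1}{\nabla}_XY}Z$;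 $\overset{5}{R}(X,Y)Z=\frac12\big(\overset{1}{\nabla}_X\overset{1}{\nabla}_YZ-\overset{2}{\nabla}_Y\overset{1}{\nabla}_XZ+\overset{2}{\nabla}_X\overset{2}{\nabla}_YZ-\overset{1}{\nabla}_Y\overset{2}{\nabla}_XZ-\overset{1}{\nabla}_{[X,Y]}Z-\overset{2}{\nabla}_{[X,Y]}Z\big)$. *)

(* Defs.v *)
From mathcomp Require Import all_boot all_order all_algebra.
From mathcomp Require Import all_classical all_reals all_analysis.

Set Implicit Arguments.
Unset Strict Implicit.
Unset Printing Implicit Defensive.

Import Order.TTheory GRing.Theory Num.Theory.
Import numFieldNormedType.Exports.

Local Open Scope classical_set_scope.
Local Open Scope ring_scope.

(* [O] is always open in uses; derivatives are Frechet derivatives. *)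

Section Smooth.
Context {R : realType} {V W : normedModType R}.

Fixpoint Ck (k : nat) (O : set V) (f : V -> W) : Prop :=
  match k with
  | 0 => forall x, O x -> {for x, continuous f}
  | k'.+1 => (forall x, O x -> differentiable f x) /\
             (forall v, Ck k' O (fun x => 'D_v f x))
  end.

Definition smooth_on (O : set V) (f : V -> W) : Prop := forall k, Ck k O f.

End Smooth.

(* [chart_inv] is the inverse homeomorphism on [chart_map @` chart_dom];
   both maps take arbitrary values off their domains. *)
Record chart (R : realType) (n : nat) (T : topologicalType) := Chart {
  chart_dom : set T;
  chart_map : T -> 'rV[R]_n;
  chart_inv : 'rV[R]_n -> T;
  chart_dom_open : open chart_dom;
  chart_img_open : open (chart_map @` chart_dom);
  chart_mapK : forall p, chart_dom p -> chart_inv (chart_map p) = p;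
  chart_map_cont : forall p, chart_dom p -> {for p, continuous chart_map};
  chart_inv_cont : forall x, (chart_map @` chart_dom) x ->
    {for x, continuous chart_inv}
}.

Definition transition (R : realType) (n : nat) (T : topologicalType)
    (c d : chart R n T) : 'rV[R]_n -> 'rV[R]_n :=
  fun x => chart_map d (chart_inv c x).

Definition compatible (R : realType) (n : nat) (T : topologicalType)
    (c d : chart R n T) : Prop :=
  smooth_on (chart_map c @` (chart_dom c `&` chart_dom d)) (transition c d).

(* The atlas need not be maximal. [chart_at p] is a preferred chart at [p]; it
   is only used to represent tangent vectors at [p] by coordinates. *)
Record manifold (R : realType) (n : nat) := Manifold {
  carrier :> topologicalType;
  atlas : set (chart R n carrier);
  chart_at : carrier -> chart R n carrier;
  manifold_nonempty : [set: carrier] !=set0;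
  manifold_hausdorff : hausdorff_space carrier;
  manifold_second_countable : @second_countable carrier;
  chart_at_atlas : forall p, atlas (chart_at p);
  chart_at_dom : forall p, chart_dom (chart_at p) p;
  atlas_compatible : forall c d, atlas c -> atlas d -> compatible c d
}.

Section Geometry.
Context {R : realType} {n : nat} {M : manifold R n}.
Implicit Types (c d : chart R n M) (p : M) (U : set M) (u v : 'rV[R]_n).

(* Membership in the maximal atlas. *)
Definition smooth_chart c : Prop :=
  forall d, atlas d -> compatible c d /\ compatible d c.

Definition smooth_fun U (f : M -> R) : Prop :=
  forall c, atlas c ->
    smooth_on (chart_map c @` (U `&` chart_dom c)) (fun x => f (chart_inv c x)).

(* A tangent vector at [p] is given by its components in [chart_at p];
   [change_chart p c d v] turns components in [c] into components in [d]
   by applying the Jacobian of the transition map at [p]. *)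
Definition change_chart p c d v : 'rV[R]_n :=
  'D_v (transition c d) (chart_map c p).

(* Not necessarily smooth: a vector field on an open set [U] is represented by
   a [vfield] that is smooth on [U], with arbitrary values off [U]. *)
Definition vfield : Type := M -> 'rV[R]_n.

Implicit Types X Y Z : vfield.

Definition in_chart X c : 'rV[R]_n -> 'rV[R]_n :=
  fun x => let p := chart_inv c x in change_chart p (chart_at p) c (X p).

Definition smooth_vf U X : Prop :=
  forall c, atlas c ->
    smooth_on (chart_map c @` (U `&` chart_dom c)) (in_chart X c).

Definition lie_der X (f : M -> R) : M -> R :=
  fun p => let c := chart_at p in
    'D_(X p) (fun x => f (chart_inv c x)) (chart_map c p).

(* [X, Y]^k = X^i d_i Y^k - Y^i d_i X^k in the coordinates [chart_at p]. *)
Definition bracket X Y : vfield :=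
  fun p => let c := chart_at p in
    'D_(X p) (in_chart Y c) (chart_map c p) -
    'D_(Y p) (in_chart X c) (chart_map c p).

(* [g p] is the Gram matrix of the scalar product of the tangent space at [p]
   in the coordinates [chart_at p]. *)
Definition metric : Type := M -> 'M[R]_n.

Definition bilin (m : nat) (A : 'M[R]_m) (u v : 'rV[R]_m) : R :=
  (u *m A *m v^T) 0 0.

Definition inner (g : metric) X Y : M -> R := fun p => bilin (g p) (X p) (Y p).

Definition minkowski : 'M[R]_n :=
  diag_mx (\row_(i < n) (if i == 0%N :> nat then -1 else 1)).

Record lorentzian (g : metric) : Prop := Lorentzian {
  metric_sym : forall p, (g p)^T = g p;
  (* the rows of [E] form a g_p-orthonormal basis *)
  metric_signature : forall p, exists E : 'M[R]_n,
    E \in unitmx /\ E *m g p *m E^T = minkowski;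
  metric_smooth : forall U X Y, open U -> smooth_vf U X -> smooth_vf U Y ->
    smooth_fun U (inner g X Y)
}.

(* A connection acts on the vector fields of every open set [U]. Compatibility
   with restriction is not listed since it follows: if [X = X'] on [U], then
   [X - X'] is its own product by the indicator function of the complement of
   [U], which is smooth on [U], and likewise for [Y]. *)
Record connection (D : vfield -> vfield -> vfield) : Prop := Connection {
  conn_smooth : forall U X Y, open U -> smooth_vf U X -> smooth_vf U Y ->
    smooth_vf U (D X Y);
  conn_addl : forall U X X' Y, open U ->
    smooth_vf U X -> smooth_vf U X' -> smooth_vf U Y ->
    forall p, U p -> D (fun q => X q + X' q) Y p = D X Y p + D X' Y p;
  conn_scalel : forall U f X Y, open U ->
    smooth_fun U f -> smooth_vf U X -> smooth_vf U Y ->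
    forall p, U p -> D (fun q => f q *: X q) Y p = f p *: D X Y p;
  conn_addr : forall U X Y Y', open U ->
    smooth_vf U X -> smooth_vf U Y -> smooth_vf U Y' ->
    forall p, U p -> D X (fun q => Y q + Y' q) p = D X Y p + D X Y' p;
  conn_leibniz : forall U f X Y, open U ->
    smooth_fun U f -> smooth_vf U X -> smooth_vf U Y ->
    forall p, U p ->
      D X (fun q => f q *: Y q) p = lie_der X f p *: Y p + f p *: D X Y p
}.

Record levi_civita (g : metric) (D : vfield -> vfield -> vfield) : Prop :=
  LeviCivita {
  lc_connection : connection D;
  lc_torsion_free : forall U X Y, open U -> smooth_vf U X -> smooth_vf U Y ->
    forall p, U p -> D X Y p - D Y X p = bracket X Y p;
  lc_metric : forall U X Y Z, open U ->
    smooth_vf U X -> smooth_vf U Y -> smooth_vf U Z ->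
    forall p, U p ->
      lie_der X (inner g Y Z) p = inner g (D X Y) Z p + inner g Y (D X Z) p
}.

Definition conn1 (g : metric) (D : vfield -> vfield -> vfield) (P : vfield) X Y
    : vfield :=
  fun p => D X Y p + inner g Y P p *: X p - inner g X Y p *: P p.

Definition conn2 (g : metric) (D : vfield -> vfield -> vfield) (P : vfield) X Y
    : vfield :=
  fun p => conn1 g D P Y X p + bracket X Y p.

Definition conn0 (g : metric) (D : vfield -> vfield -> vfield) (P : vfield) X Y
    : vfield :=
  fun p => 2^-1 *: (conn1 g D P X Y p + conn2 g D P X Y p).

Definition parallel (D : vfield -> vfield -> vfield) (P : vfield) : Prop :=
  forall U X, open U -> smooth_vf U X -> forall p, U p -> D X P p = 0.

(* [D0], [D1], [D2] stand for [conn0], [conn1], [conn2]. *)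

Definition curv0 (D0 : vfield -> vfield -> vfield) X Y Z : vfield :=
  fun p => D0 X (D0 Y Z) p - D0 Y (D0 X Z) p - D0 (bracket X Y) Z p.

Definition curv4 (D1 D2 : vfield -> vfield -> vfield) X Y Z : vfield :=
  fun p => D2 X (D1 Y Z) p - D1 Y (D2 X Z) p
           + D2 (D2 Y X) Z p - D1 (D1 X Y) Z p.

Definition curv5 (D1 D2 : vfield -> vfield -> vfield) X Y Z : vfield :=
  fun p => 2^-1 *: (D1 X (D1 Y Z) p - D2 Y (D1 X Z) p
                    + D2 X (D2 Y Z) p - D1 Y (D2 X Z) p
                    - D1 (bracket X Y) Z p - D2 (bracket X Y) Z p).

(* The value of a tensor at [p] on tangent vectors x, y, z is computed from
   arbitrary vector fields extending x, y, z to a neighbourhood of [p], so a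
   tensor field is zero iff it vanishes on vector fields of all open sets. *)
Definition tensor_zero (T : vfield -> vfield -> vfield -> vfield) : Prop :=
  forall U X Y Z, open U -> smooth_vf U X -> smooth_vf U Y -> smooth_vf U Z ->
    forall p, U p -> T X Y Z p = 0.

(* The metric at [p] evaluated on vectors given by components in [c]. *)
Definition metric_in (g : metric) c p u v : R :=
  bilin (g p) (change_chart p c (chart_at p) u)
              (change_chart p c (chart_at p) v).

Definition riemannian_on (m : nat) (W : set 'rV[R]_m)
    (h : 'rV[R]_m -> 'M[R]_m) : Prop :=
  smooth_on W h /\
  forall x, W x -> (h x)^T = h x /\
    forall u : 'rV[R]_m, u != 0 -> 0 < bilin (h x) u u.

(* Near [p], coordinates (x^t, (x^i)_(i != t)) with values in ]a, b[ * W put the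
   metric in the form -(dx^t)^2 + f(x^t)^2 h; [col' t] deletes the component of
   index [t]. *)
Definition warped_at (g : metric) p : Prop :=
  exists (c : chart R n M) (t : 'I_n) (a b : R) (W : set 'rV[R]_n.-1)
         (f : R -> R) (h : 'rV[R]_n.-1 -> 'M[R]_n.-1),
    [/\ smooth_chart c /\ chart_dom c p,
        chart_map c @` chart_dom c =
          [set x : 'rV[R]_n | a < x 0 t < b /\ W (col' t x)],
        open W /\ riemannian_on W h,
        smooth_on [set s : R | a < s < b] f /\ (forall s, a < s < b -> 0 < f s)
      & forall q u v, chart_dom c q ->
          let x := chart_map c q in
          metric_in g c q u v =
            - (u 0 t * v 0 t)
            + f (x 0 t) ^+ 2 * bilin (h (col' t x)) (col' t u) (col' t v)].

Definition GRW (g : metric) : Prop := lorentzian g /\ forall p, warped_at g p.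

End Geometry.

Arguments vfield {R n} M.
Arguments metric {R n} M.

(* Main.v *)
Require Import Defs.
From HB Require Import structures.
From mathcomp Require Import all_boot all_order all_algebra.
From mathcomp Require Import all_classical all_reals all_analysis.
From mathcomp Require Import ring.
Import Order.TTheory GRing.Theory Num.Theory.
Import numFieldNormedType.Exports.
Local Open Scope classical_set_scope.
Local Open Scope ring_scope.

Set Implicit Arguments.
Unset Strict Implicit.
Unset Printing Implicit Defensive.

(** Write nabla for the Levi-Civita connection and pi for g(., P).  That P is
parallel for the first connection means nabla_X P = X + pi(X) P.  Let X be a
vector field orthogonal to P on an open set.  Then nabla_X P = X, and
nabla_P P = 0 since pi(P) = -1; moreover nabla_P X is again orthogonal to P, by
differentiating g(X, P) = 0 along P, and [X, P] = X - nabla_P X.  Evaluating the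
three curvatures on (X, P, P), every second covariant derivative then reduces to
a combination of X and nabla_P X, the terms in nabla_P X cancel, and what is
left is
  R0(X, P)P = - X / 4,   R4(X, P)P = - X,   R5(X, P)P = - X / 2
([curv0_XPP], [curv4_XPP], [curv5_XPP]).

It remains to find such an X that does not vanish at some point p.  In dimension
at least 2 some tangent vector v at p is not a multiple of P
([exists_not_multiple]).  Extend v to the field E with constant components in a
chart around p, and take X := nabla_E P = E + pi(E) P: this is the orthogonal
projection of E, it is nonzero at p, and it is smooth because a connection
preserves smoothness.

Two facts of differential geometry support this.  A coordinate field is smooth
when seen from every other chart ([coord_field_smooth]); this rests on the chain
rule for maps of class C^k ([Ck_comp]).  And a connection is local
([conn_zero_r], [conn_ext_r]), so that in iterated derivatives the inner field
may be replaced by its value on the open set at hand. *)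

(** * Calculus of maps of class C^k *)

Section Calculus.
Context {R : realType}.
Implicit Types (V W Z : normedModType R) (k : nat).

Lemma near_eq_differentiable V W (f h : V -> W) (x : V) :
  (\near x, f x = h x) -> differentiable f x -> differentiable h x.
Proof.
move=> fh df.
have hf0 : \near x, (h - f) x = 0.
  by near=> y; rewrite !fctE (near fh y) ?subrr.
(* h - f vanishes near x, so its differential at x is the zero map *)
have o0 : (h - f) \o shift x = cst ((h - f) x) + \0 +o_ 0 id.
  apply/eqaddoP => e e0; near=> y.
  rewrite !fctE /= addr0 -[h x - f x]/((h - f) x) (nbhs_singleton hf0) subr0.
  have -> : h (y + x) - f (y + x) = 0.
    by near: y; move: hf0; rewrite (near_shift 0) subr0.
  by rewrite normr0 mulr_ge0// ltW.
have c0 : continuous (\0 : V -> W) by exact: cst_continuous.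
rewrite (_ : h = f + (h - f)); last by rewrite addrC subrK.
apply: differentiableD => //; apply/diff_locallyP.
by rewrite (diff_unique (df := \0 : {linear V -> W}) c0 o0).
Unshelve. all: by end_near. Qed.

Lemma open_near V (O : set V) (Q : V -> Prop) x : open O -> O x ->
  (forall y, O y -> Q y) -> \near x, Q x.
Proof. by move=> oO Ox OQ; near=> y; apply: OQ; near: y; exact: open_nbhs_nbhs.
Unshelve. all: by end_near. Qed.

(** [Ck] constrains [f] only on [O], but its derivatives are formed in the
ambient space: openness of [O] makes the property depend on the values of [f]
on [O] alone. *)
Lemma Ck_ext V W k (O : set V) (f h : V -> W) : open O ->
  (forall x, O x -> f x = h x) -> Ck k O f -> Ck k O h.
Proof.
move=> oO; elim: k f h => [|k IH] f h fh /=.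
  move=> cf x Ox; rewrite /prop_for /continuous_at -(fh x Ox).
  apply: cvg_trans (cf x Ox); apply: near_eq_cvg.
  exact: open_near oO Ox fh.
move=> [df cf]; split=> [x Ox|v].
  exact: near_eq_differentiable (open_near oO Ox fh) (df x Ox).
apply: IH (cf v) => x Ox; exact: near_eq_derive (open_near oO Ox fh).
Qed.

Lemma Ck_sub V W k (O O' : set V) (f : V -> W) :
  O' `<=` O -> Ck k O f -> Ck k O' f.
Proof.
move=> sO; elim: k f => [|k IH] f; first by move=> cf x /sO; exact: cf.
by move=> [df Df]; split=> [x /sO|v]; [exact: df|exact/IH/Df].
Qed.

Lemma CkS V W k (O : set V) (f : V -> W) : Ck k.+1 O f -> Ck k O f.
Proof.
elim: k f => [|k IH] f [df cf].
  by move=> x Ox; exact/differentiable_continuous/df.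
by split=> // v; exact: IH.
Qed.

Lemma Ck_cst V W k (O : set V) (w : W) : Ck k O (fun=> w).
Proof.
elim: k w => [|k IH] w /=; first by move=> x _; exact: cst_continuous.
split=> [x _|v]; first exact: differentiable_cst.
have -> : (fun x => 'D_v (fun=> w) x) = (fun=> 0 : W).
  by apply/funext => x; exact: derive_cst.
exact: IH.
Qed.

Lemma CkD V W k (O : set V) (f h : V -> W) : open O ->
  Ck k O f -> Ck k O h -> Ck k O (fun x => f x + h x).
Proof.
move=> oO; elim: k f h => [|k IH] f h /=.
  by move=> cf ch x Ox; apply: continuousD; [exact: cf|exact: ch].
move=> [df cf] [dh ch]; split=> [x Ox|v].
  by apply: differentiableD; [exact: df|exact: dh].
apply: Ck_ext (IH _ _ (cf v) (ch v)) => // x Ox; apply/esym/deriveD.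
  exact/diff_derivable/df.
exact/diff_derivable/dh.
Qed.

Lemma Ck_sum V W k (O : set V) m (F : 'I_m -> V -> W) : open O ->
  (forall i, Ck k O (F i)) -> Ck k O (fun x => \sum_(i < m) F i x).
Proof.
move=> oO; elim: m F => [|m IH] F cF.
  apply: Ck_ext (Ck_cst _ _ 0) => // x _; by rewrite big_ord0.
apply: Ck_ext (CkD oO (IH _ (fun i => cF (widen_ord (leqnSn m) i)))
  (cF ord_max)) => // x _; by rewrite big_ord_recr.
Qed.

(** The Leibniz rule for a scalar function times a vector-valued function, as
the chain rule for the continuous bilinear map [*:%R]. *)
Lemma differentiable_scale V W (a : V -> R) (f : V -> W) x :
  differentiable a x -> differentiable f x ->
  is_diff x (fun y => a y *: f y)
    (fun v => a x *: 'd f x v + 'd a x v *: f x).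
Proof.
move=> da df.
have lin : bilinear_for
    (GRing.Scale.Law.clone _ _ *:%R _) (GRing.Scale.Law.clone _ _ *:%R _)
    (@GRing.scale R W).
  by split=> [w|c] b y z /=; rewrite ?scalerDl ?scalerDr ?scalerA // mulrC.
pose sM := bilinear_isBilinear.Build R R W W _ _ (@GRing.scale R W) lin.
pose sB : {bilinear R -> W -> W} := HB.pack (@GRing.scale R W) sM.
have sc : continuous (fun q : R * W => sB q.1 q.2).
  exact: (@scale_continuous R W).
have dp := differentiable_pair da df.
rewrite (_ : (fun y => _) =
  (fun q : R * W => sB q.1 q.2) \o (fun y => (a y, f y))) //.
apply: DiffDef.
  exact/differentiable_comp/differentiable_bilin.
rewrite diff_comp//; last exact/differentiable_bilin.
by rewrite (diff_bilin (f := sB)) // diff_pair.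
Qed.

Lemma Ck_scale V W k (O : set V) (a : V -> R) (f : V -> W) : open O ->
  Ck k O a -> Ck k O f -> Ck k O (fun x => a x *: f x).
Proof.
move=> oO; elim: k a f => [|k IH] a f ca cf /=.
  by move=> x Ox; apply: continuousZ; [exact: ca|exact: cf].
have [da Da] := ca; have [df Df] := cf.
split=> [x Ox|v].
  by have [] := differentiable_scale (da x Ox) (df x Ox).
apply: Ck_ext (CkD oO (IH _ _ (CkS ca) (Df v)) (IH _ _ (Da v) (CkS cf))) => //.
move=> x Ox; have [dp vp] := differentiable_scale (da x Ox) (df x Ox).
by rewrite (deriveE _ dp) vp (deriveE _ (da x Ox)) (deriveE _ (df x Ox)).
Qed.

Lemma Ck_coord V k m (O : set V) (f : V -> 'rV[R]_m) i : open O ->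
  Ck k O f -> Ck k O (fun x => f x 0 i).
Proof.
move=> oO; elim: k f => [|k IH] f /=.
  move=> cf x Ox; apply: (@continuous_comp _ _ _ f (fun A => A 0 i)).
    exact: cf.
  exact: coord_continuous.
move=> [df Df]; split=> [x Ox|v].
  exact: (differentiable_comp (df x Ox) (differentiable_coord _ 0 i)).
apply: Ck_ext (IH _ (Df v)) => // x Ox.
by rewrite derive_mx ?mxE//; exact/diff_derivable/df.
Qed.

Lemma derive_comp V W Z (f : W -> Z) (h : V -> W) x v :
  differentiable h x -> differentiable f (h x) ->
  'D_v (f \o h) x = 'D_('D_v h x) f (h x).
Proof.
move=> dh df; rewrite (deriveE _ (differentiable_comp dh df)) diff_comp//=.
by rewrite (deriveE _ dh) (deriveE _ df).
Qed.

Lemma derive_lin V W (f : V -> W) x a u v : differentiable f x ->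
  'D_(a *: u + v) f x = a *: 'D_u f x + 'D_v f x.
Proof. by move=> df; rewrite !(deriveE _ df) linearP. Qed.

(** Induction on [k]: by the chain rule, [D_v (f o h)] is the sum over [i] of the
i-th component of [D_v h] times [D_(e_i) f o h].  Expanding along the basis is
what brings back derivatives of [f] in fixed directions, the only ones that
[Ck] speaks of. *)
Lemma Ck_comp V W k m (O : set V) (O' : set 'rV[R]_m)
    (f : 'rV[R]_m -> W) (h : V -> 'rV[R]_m) : open O -> open O' ->
  (forall x, O x -> O' (h x)) -> Ck k O' f -> Ck k O h -> Ck k O (f \o h).
Proof.
move=> oO oO' hO; elim: k f h hO => [|k IH] f h hO cf ch.
  by move=> x Ox; apply: continuous_comp; [exact: ch|exact/cf/hO].
have [df Df] := cf; have [dh Dh] := ch.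
split=> [x Ox|v].
  by apply: differentiable_comp; [exact: dh|exact/df/hO].
have cp i : Ck k O (fun x => 'D_v h x 0 i *: 'D_(delta_mx 0 i) f (h x)).
  apply: Ck_scale => //; first exact: (Ck_coord i oO (Dh v)).
  exact: (IH _ _ hO (Df _) (CkS ch)).
apply: Ck_ext (Ck_sum oO cp) => // x Ox.
have dfx := df _ (hO _ Ox); rewrite (derive_comp _ (dh x Ox) dfx).
rewrite (deriveE _ dfx) [in RHS](row_sum_delta ('D_v h x)) linear_sum.
by apply: eq_bigr => i _; rewrite linearZ (deriveE _ dfx).
Qed.

End Calculus.

(** * Charts and smooth vector fields *)

Section Charts.
Context {R : realType} {n : nat} {M : manifold R n}.
Implicit Types (b c d : chart R n M) (p q : M) (U : set M) (u v : 'rV[R]_n).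
Implicit Types X Y Z : vfield M.

Lemma open_chart_image c U : open U ->
  open (chart_map c @` (U `&` chart_dom c)).
Proof.
move=> oU; rewrite openE => _ [q [Uq dq] <-]; rewrite /interior.
have im : (chart_map c @` chart_dom c) (chart_map c q) by exists q.
have nU : nbhs (chart_map c q) (chart_inv c @^-1` U).
  apply: (chart_inv_cont im); rewrite chart_mapK//.
  exact: open_nbhs_nbhs.
have nI := open_nbhs_nbhs (conj (chart_img_open (c := c)) im).
apply: filterS (filterI nI nU) => _ [[r dr <-]] /=.
by rewrite chart_mapK// => Ur; exists r.
Qed.

(** First-order content of the compatibility of charts; it makes the change of
components of tangent vectors linear. *)
Lemma transition_differentiable c d p : atlas c -> atlas d ->
  chart_dom c p -> chart_dom d p ->
  differentiable (transition c d) (chart_map c p).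
Proof.
move=> Ac Ad cp dp; have [+ _] := atlas_compatible Ac Ad 1.
by apply; exists p.
Qed.

Lemma change_chart_lin c d p a u v : atlas c -> atlas d ->
  chart_dom c p -> chart_dom d p ->
  change_chart p c d (a *: u + v) =
  a *: change_chart p c d u + change_chart p c d v.
Proof.
by move=> Ac Ad cp dp; exact/derive_lin/transition_differentiable.
Qed.

(** Chain rule for the cocycle identity of transition maps. *)
Lemma change_chart_comp b c d p v : atlas b -> atlas c -> atlas d ->
  chart_dom b p -> chart_dom c p -> chart_dom d p ->
  change_chart p b d (change_chart p c b v) = change_chart p c d v.
Proof.
move=> Ab Ac Ad bp cp dp; rewrite /change_chart.
have Tp : transition c b (chart_map c p) = chart_map b p.
  by rewrite /transition chart_mapK.
have := derive_comp (f := transition b d) (h := transition c b)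
  (x := chart_map c p) v (transition_differentiable Ac Ab cp bp).
rewrite Tp => <-; last exact: transition_differentiable.
apply: near_eq_derive.
apply: (open_near (O := chart_map c @` (chart_dom b `&` chart_dom c))).
- exact/open_chart_image/chart_dom_open.
- by exists p.
by move=> _ [q [bq cq] <-]; rewrite /= /transition (chart_mapK cq) (chart_mapK bq).
Qed.

Lemma change_chart_id c p v : chart_dom c p -> change_chart p c c v = v.
Proof.
move=> cp; rewrite /change_chart -[RHS](derive_id (chart_map c p) v).
apply: near_eq_derive.
apply: (open_near (O := chart_map c @` chart_dom c)).
- exact: chart_img_open.
- by exists p.
by move=> _ [q cq <-]; rewrite /transition chart_mapK.
Qed.

Lemma smooth_vf_ext U X Y : open U -> (forall p, U p -> X p = Y p) ->
  smooth_vf U X -> smooth_vf U Y.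
Proof.
move=> oU XY sX c Ac k; apply: Ck_ext (sX c Ac k); first exact: open_chart_image.
by move=> _ [q [Uq cq] <-]; rewrite /in_chart chart_mapK// XY.
Qed.

Lemma smooth_vf0 U : open U -> smooth_vf U (fun _ : M => 0).
Proof.
move=> oU c Ac k; apply: Ck_ext (Ck_cst k _ 0); first exact: open_chart_image.
by move=> x _; rewrite /in_chart /change_chart derive0.
Qed.

Lemma smooth_vf_zero U Z : open U ->
  (forall q, U q -> Z q = 0) -> smooth_vf U Z.
Proof. by move=> oU Z0; apply: smooth_vf_ext (smooth_vf0 oU) => // q /Z0. Qed.

Lemma smooth_vf_sub U U' X : U' `<=` U -> smooth_vf U X -> smooth_vf U' X.
Proof.
move=> sU sX c Ac k; apply: Ck_sub (sX c Ac k).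
by move=> _ [q [/sU Uq cq] <-]; exists q.
Qed.

Lemma smooth_vf_lin U a X Y : open U -> smooth_vf U X -> smooth_vf U Y ->
  smooth_vf U (fun q => a *: X q + Y q).
Proof.
move=> oU sX sY c Ac k; have oI := open_chart_image (c := c) oU.
apply: Ck_ext (CkD oI (Ck_scale oI (Ck_cst k _ a) (sX c Ac k)) (sY c Ac k)) => //.
move=> _ [q [Uq cq] <-]; rewrite /in_chart chart_mapK// change_chart_lin//.
  exact: chart_at_atlas.
exact: chart_at_dom.
Qed.

Lemma smooth_fun_ext U f h : open U -> (forall p : M, U p -> f p = h p) ->
  smooth_fun U f -> smooth_fun U h.
Proof.
move=> oU fh sf c Ac k; apply: Ck_ext (sf c Ac k); first exact: open_chart_image.
by move=> _ [q [Uq cq] <-]; rewrite chart_mapK// fh.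
Qed.

Lemma smooth_fun_cst U a : smooth_fun U (fun _ : M => a).
Proof. by move=> c Ac k; exact: Ck_cst. Qed.

Lemma lie_der_ext U X (f h : M -> R) p : open U -> U p ->
  (forall q, U q -> f q = h q) -> lie_der X f p = lie_der X h p.
Proof.
move=> oU Up fh; apply: near_eq_derive.
apply: (open_near (O := chart_map (chart_at p) @` (U `&` chart_dom (chart_at p)))).
- exact: open_chart_image.
- by exists p => //; split=> //; exact: chart_at_dom.
by move=> _ [q [Uq cq] <-]; rewrite chart_mapK// fh.
Qed.

Lemma lie_der_cst X a p : lie_der X (fun _ : M => a) p = 0.
Proof. exact: derive_cst. Qed.

Definition coord_field c v : vfield M :=
  fun q => change_chart q c (chart_at q) v.

(** Seen in another chart [d], the field with constant components [v] in [c] is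
[D_v (transition c d)] composed with the transition from [d] back to [c]. *)
Lemma coord_field_smooth c v : atlas c -> smooth_vf (chart_dom c) (coord_field c v).
Proof.
move=> Ac d Ad k; have oc := open_chart_image (c := d) (chart_dom_open c).
have od := open_chart_image (c := c) (chart_dom_open d).
have [_ Dcd] := atlas_compatible Ac Ad k.+1.
have sdc : Ck k (chart_map d @` (chart_dom c `&` chart_dom d)) (transition d c).
  by rewrite setIC; exact: atlas_compatible.
rewrite setIC in Dcd.
apply: Ck_ext (Ck_comp oc od _ (Dcd v) sdc) => //.
  move=> _ [q [cq dq] <-] /=; rewrite /in_chart /coord_field chart_mapK//.
  rewrite change_chart_comp//; try exact: chart_at_atlas; try exact: chart_at_dom.
  by rewrite /change_chart /transition chart_mapK.
by move=> _ [q [cq dq] <-]; exists q => //; rewrite /transition chart_mapK.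
Qed.

Lemma coord_field_at p v : coord_field (chart_at p) v p = v.
Proof. exact/change_chart_id/chart_at_dom. Qed.

End Charts.

(** * Locality of connections, linear algebra of the metric *)

Section Connections.
Context {R : realType} {n : nat} {M : manifold R n}.
Implicit Types (X Y Z : vfield M) (U : set M) (p q : M).

Section Locality.
Context (D : vfield M -> vfield M -> vfield M) (D_conn : connection D).

Lemma smooth_fun_indicC U : open U -> smooth_fun U (fun q : M => \1_(~` U) q : R).
Proof.
move=> oU; apply: smooth_fun_ext (smooth_fun_cst U 0) => // p Up.
by rewrite indicE memNset.
Qed.

Lemma indicC_scale U X : (forall p, U p -> X p = 0) ->
  X = (fun q => (\1_(~` U) q : R) *: X q).
Proof.
move=> X0; apply/funext => q; rewrite indicE; have [Uq|nUq] := pselect (U q).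
  by rewrite X0// scaler0.
by rewrite mem_set// scale1r.
Qed.

(** Locality of a connection: a field that vanishes on [U] is its own product by
the indicator function of the complement of [U], which is smooth on [U] since it
is zero there; the Leibniz rule then kills the derivative. *)
Lemma conn_zero_r U X Y p : open U -> smooth_vf U X -> U p ->
  (forall q, U q -> Y q = 0) -> D X Y p = 0.
Proof.
move=> oU sX Up Y0; rewrite (indicC_scale Y0).
have sY := smooth_vf_zero oU Y0.
rewrite (conn_leibniz D_conn oU (smooth_fun_indicC oU) sX sY Up) Y0// scaler0.
by rewrite indicE memNset// scale0r addr0.
Qed.

Lemma conn_lin_r U a X Y Y' p : open U -> smooth_vf U X -> smooth_vf U Y ->
  smooth_vf U Y' -> U p ->
  D X (fun q => a *: Y q + Y' q) p = a *: D X Y p + D X Y' p.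
Proof.
move=> oU sX sY sY' Up.
have saY : smooth_vf U (fun q => a *: Y q).
  apply: smooth_vf_ext (smooth_vf_lin a oU sY (smooth_vf0 oU)) => // q _.
  by rewrite addr0.
rewrite (conn_addr D_conn oU sX saY sY' Up).
rewrite (conn_leibniz D_conn oU (smooth_fun_cst U a) sX sY Up).
by rewrite lie_der_cst scale0r add0r.
Qed.

Lemma conn_ext_r U X Y Y' p : open U -> smooth_vf U X -> smooth_vf U Y ->
  U p -> (forall q, U q -> Y q = Y' q) -> D X Y p = D X Y' p.
Proof.
move=> oU sX sY Up YY'.
have sY' := smooth_vf_ext oU YY' sY.
have := conn_zero_r oU sX Up (Y := fun q => -1 *: Y q + Y' q).
rewrite (conn_lin_r (-1) oU sX sY sY' Up) scaleN1r => /(_ _)/eqP.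
rewrite addrC subr_eq0 => H; apply/esym/eqP/H => q Uq.
by rewrite YY'// scaleN1r addNr.
Qed.

End Locality.

Section Inner.
Context (g : metric M).

Lemma bilinDl (m : nat) (A : 'M[R]_m) u v w :
  bilin A (u + v) w = bilin A u w + bilin A v w.
Proof. by rewrite /bilin !mulmxDl mxE. Qed.

Lemma bilinZl (m : nat) (A : 'M[R]_m) a u w : bilin A (a *: u) w = a * bilin A u w.
Proof. by rewrite /bilin -!scalemxAl mxE. Qed.

Lemma inner0 X Y p : Y p = 0 -> inner g X Y p = 0.
Proof. by move=> Y0; rewrite /inner /bilin Y0 trmx0 mulmx0 mxE. Qed.

Lemma innerC X Y p : lorentzian g -> inner g X Y p = inner g Y X p.
Proof.
move=> gL; rewrite /inner /bilin -[in RHS](Defs.metric_sym gL p).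
by rewrite -[in LHS](trmxK (X p *m _ *m _)) mxE !trmx_mul trmxK mulmxA.
Qed.

End Inner.
End Connections.

(** If [v + (v A w^T) w] vanished for all [v], the identity matrix would be
the product of a column and a row, of rank at most 1. *)
Lemma exists_not_multiple (R : fieldType) (n : nat) (A : 'M[R]_n) (w : 'rV[R]_n) :
  (2 <= n)%N -> exists v : 'rV[R]_n, v + (v *m A *m w^T) 0 0 *: w != 0.
Proof.
move=> n2; apply: contrapT => H.
have E : 1%:M = - (A *m w^T) *m w.
  apply/eqP; rewrite mulNmx -addr_eq0; apply/eqP/row_matrixP => i.
  rewrite row0 rowE mulmxDr mulmx1; apply: contrapT => /eqP vw; apply: H.
  exists (delta_mx 0 i); apply: contra_neq vw => <-.
  by rewrite !mulmxA -mul_scalar_mx -mx11_scalar.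
have := mxrankM_maxl (- (A *m w^T)) w; rewrite -E mxrank1.
by move=> /leq_trans/(_ (rank_leq_col _)); rewrite leqNgt n2.
Qed.

(** * Curvatures of a semi-symmetric metric P-connection *)

Section TorseForming.
Context {R : realType} {n : nat} {M : manifold R n}.
Implicit Types (X Y Z : vfield M) (U : set M) (p q : M).
Context (g : metric M) (g_lor : lorentzian g).
Context (D : vfield M -> vfield M -> vfield M) (D_LC : levi_civita g D).
Context (P : vfield M) (P_smooth : smooth_vf setT P).
Context (P_unit : forall p : M, inner g P P p = -1).
Context (P_conn : parallel (conn1 g D P) P).

Local Notation D0 := (conn0 g D P).
Local Notation D1 := (conn1 g D P).
Local Notation D2 := (conn2 g D P).
Local Notation D_conn := (lc_connection D_LC).

Lemma smooth_P U : smooth_vf U P.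
Proof. exact: smooth_vf_sub P_smooth. Qed.

(** The bracket in the second connection is traded for nabla, which has no
torsion. *)
Lemma conn2E U X Y p : open U -> smooth_vf U X -> smooth_vf U Y -> U p ->
  D2 X Y p = D X Y p + inner g X P p *: Y p - inner g X Y p *: P p.
Proof.
move=> oU sX sY Up; rewrite /conn2 /conn1 (innerC Y X p g_lor).
rewrite -(lc_torsion_free D_LC oU sX sY Up).
by apply/rowP => i; rewrite !mxE; ring.
Qed.

Lemma conn0E U X Y p : open U -> smooth_vf U X -> smooth_vf U Y -> U p ->
  D0 X Y p = D X Y p + 2^-1 *: (inner g Y P p *: X p + inner g X P p *: Y p)
    - inner g X Y p *: P p.
Proof.
move=> oU sX sY Up; rewrite /conn0 (conn2E oU sX sY Up) /conn1.
by apply/rowP => i; rewrite !mxE; field.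
Qed.

(** The hypothesis that P is parallel for the first connection, rewritten with
[pi(P) = -1]. *)
Lemma nabla_P U X p : open U -> smooth_vf U X -> U p ->
  D X P p = X p + inner g X P p *: P p.
Proof.
move=> oU sX Up; have := P_conn oU sX Up; rewrite /conn1 P_unit.
move=> /rowP H; apply/rowP => i; have := H i; rewrite !mxE => /eqP.
by rewrite mulN1r subr_eq0 subr_eq addrC => /eqP ->.
Qed.

Lemma conn2_P U X p : open U -> smooth_vf U X -> U p ->
  D2 X P p = X p + inner g X P p *: P p.
Proof.
move=> oU sX Up.
by rewrite (conn2E oU sX (smooth_P U) Up) (nabla_P oU sX Up) addrK.
Qed.

Lemma conn0_P U X p : open U -> smooth_vf U X -> U p ->
  D0 X P p = 2^-1 *: (X p + inner g X P p *: P p).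
Proof.
move=> oU sX Up.
rewrite (conn0E oU sX (smooth_P U) Up) (nabla_P oU sX Up) P_unit.
by apply/rowP => i; rewrite !mxE; field.
Qed.

Lemma conn1_zero_r U X Y p : open U -> smooth_vf U X -> U p ->
  (forall q, U q -> Y q = 0) -> D1 X Y p = 0.
Proof.
move=> oU sX Up Y0; rewrite /conn1 (conn_zero_r D_conn oU sX Up Y0).
by rewrite (innerC Y P p g_lor) !inner0 ?Y0// !scale0r addr0 subr0.
Qed.

Lemma conn2_zero_r U X Y p : open U -> smooth_vf U X -> U p ->
  (forall q, U q -> Y q = 0) -> D2 X Y p = 0.
Proof.
move=> oU sX Up Y0; have sY := smooth_vf_zero oU Y0.
rewrite (conn2E oU sX sY Up) (conn_zero_r D_conn oU sX Up Y0).
by rewrite (inner0 g X (Y0 p Up)) Y0// scaler0 scale0r addr0 subr0.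
Qed.

Lemma conn0_zero_r U X Y p : open U -> smooth_vf U X -> U p ->
  (forall q, U q -> Y q = 0) -> D0 X Y p = 0.
Proof.
move=> oU sX Up Y0.
by rewrite /conn0 (conn1_zero_r oU sX Up Y0) (conn2_zero_r oU sX Up Y0) addr0
   scaler0.
Qed.

Lemma conn1_P U X p : open U -> smooth_vf U X -> U p -> D1 X P p = 0.
Proof. by move=> oU sX Up; exact: (P_conn oU sX Up). Qed.

Section Orthogonal.
Context (U : set M) (oU : open U) (X : vfield M) (sX : smooth_vf U X).
Context (X_orth : forall p, U p -> inner g X P p = 0).

(** Differentiate [g(X, P) = 0] along P and use [nabla_P P = 0]. *)
Lemma nabla_P_orth p : U p -> inner g (D P X) P p = 0.
Proof.
move=> Up; have sP := smooth_P U.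
have := lc_metric D_LC oU sP sX sP Up.
rewrite (lie_der_ext (h := fun=> 0) P oU Up X_orth) lie_der_cst.
rewrite [inner g X _ _]inner0 ?addr0 => [<- //|].
by rewrite (nabla_P oU sP Up) P_unit scaleN1r subrr.
Qed.

Lemma bracket_XP q : U q -> bracket X P q = -1 *: D P X q + X q.
Proof.
move=> Uq; rewrite -(lc_torsion_free D_LC oU sX (smooth_P U) Uq).
by rewrite (nabla_P oU sX Uq) X_orth// scale0r addr0 scaleN1r addrC.
Qed.

Lemma bracket_XP_smooth : smooth_vf U (bracket X P).
Proof.
have sDPX := conn_smooth D_conn oU (smooth_P U) sX.
apply: smooth_vf_ext (smooth_vf_lin (-1) oU sDPX sX) => // q Uq.
by rewrite bracket_XP.
Qed.

Lemma bracket_XP_orth p : U p -> inner g (bracket X P) P p = 0.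
Proof.
move=> Up; rewrite /inner bracket_XP// bilinDl bilinZl.
rewrite -/(inner g X P p) -/(inner g (D P X) P p) X_orth// nabla_P_orth//.
by rewrite mulr0 addr0.
Qed.

Lemma conn2_XP q : U q -> D2 X P q = X q.
Proof. by move=> Uq; rewrite (conn2_P oU sX Uq) X_orth// scale0r addr0. Qed.

Lemma conn0_XP q : U q -> D0 X P q = 2^-1 *: X q.
Proof. by move=> Uq; rewrite (conn0_P oU sX Uq) X_orth// scale0r addr0. Qed.

Lemma conn1_P_XP p : U p -> D1 P (D2 X P) p = D P X p.
Proof.
move=> Up; have sP := smooth_P U.
rewrite /conn1 -(conn_ext_r D_conn oU sP sX Up (fun q Uq => esym (conn2_XP Uq))).
rewrite /inner conn2_XP// -/(inner g X P p) -/(inner g P X p).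
by rewrite (innerC P X p g_lor) X_orth// !scale0r addr0 subr0.
Qed.

Lemma conn2_PX q : U q -> D2 P X q = -1 *: X q + D P X q.
Proof.
move=> Uq; rewrite (conn2E oU (smooth_P U) sX Uq) P_unit (innerC P X q g_lor).
by rewrite X_orth// scale0r subr0 addrC.
Qed.

Lemma conn2_PX_P p : U p -> D2 (D2 P X) P p = - X p + D P X p.
Proof.
move=> Up; have sW : smooth_vf U (D2 P X).
  have sDPX := conn_smooth D_conn oU (smooth_P U) sX.
  apply: smooth_vf_ext (smooth_vf_lin (-1) oU sX sDPX) => // q Uq.
  by rewrite conn2_PX.
rewrite (conn2_P oU sW Up) /inner !conn2_PX// bilinDl bilinZl.
rewrite -/(inner g X P p) -/(inner g (D P X) P p) X_orth// nabla_P_orth//.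
by rewrite mulr0 addr0 scale0r addr0 scaleN1r.
Qed.

Lemma conn0_P_XP p : U p -> D0 P (D0 X P) p = 2^-1 *: D P X p - 4^-1 *: X p.
Proof.
move=> Up; have sP := smooth_P U.
(* the summand 0 presents X / 2 as a linear combination of two smooth fields *)
have hXE q : U q -> 2^-1 *: X q + 0 = D0 X P q.
  by move=> Uq; rewrite conn0_XP ?addr0.
have shX := smooth_vf_lin 2^-1 oU sX (smooth_vf0 oU).
have sXP := smooth_vf_ext oU hXE shX.
rewrite (conn0E oU sP sXP Up) -(conn_ext_r D_conn oU sP shX Up hXE).
rewrite (conn_lin_r D_conn 2^-1 oU sP sX (smooth_vf0 oU) Up).
rewrite (conn_zero_r D_conn (Y := fun=> 0) oU sP Up)// (innerC P (D0 X P) p g_lor).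
rewrite P_unit /inner !conn0_XP// bilinZl -/(inner g X P p) X_orth//.
by apply/rowP => i; rewrite !mxE; field.
Qed.

(** In each curvature below, a field that gets differentiated is P, zero on [U],
or a constant multiple of [X]; only multiples of [X] and [nabla_P X] survive,
and the latter cancel. *)
Lemma curv4_XPP p : U p -> curv4 D1 D2 X P P p = - X p.
Proof.
move=> Up; have sP := smooth_P U; rewrite /curv4.
have z1 q : U q -> D1 P P q = 0 by move=> Uq; exact: conn1_P oU sP Uq.
have z2 q : U q -> D1 X P q = 0 by move=> Uq; exact: conn1_P oU sX Uq.
rewrite (conn2_zero_r oU sX Up z1) (conn1_P oU (smooth_vf_zero oU z2) Up).
by rewrite conn1_P_XP// conn2_PX_P// sub0r subr0 addrCA addNr addr0.
Qed.

Lemma curv5_XPP p : U p -> curv5 D1 D2 X P P p = - 2^-1 *: X p.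
Proof.
move=> Up; have sP := smooth_P U; rewrite /curv5.
have z1 q : U q -> D1 P P q = 0 by move=> Uq; exact: conn1_P oU sP Uq.
have z2 q : U q -> D1 X P q = 0 by move=> Uq; exact: conn1_P oU sX Uq.
have z3 q : U q -> D2 P P q = 0.
  by move=> Uq; rewrite (conn2_P oU sP Uq) P_unit scaleN1r subrr.
have sB := bracket_XP_smooth.
rewrite (conn1_zero_r oU sX Up z1) (conn2_zero_r oU sP Up z2).
rewrite (conn2_zero_r oU sX Up z3) conn1_P_XP// (conn1_P oU sB Up).
rewrite (conn2_P oU sB Up) bracket_XP_orth// bracket_XP//.
by apply/rowP => i; rewrite !mxE; field.
Qed.

Lemma curv0_XPP p : U p -> curv0 D0 X P P p = - 4^-1 *: X p.
Proof.
move=> Up; have sP := smooth_P U; rewrite /curv0.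
have z q : U q -> D0 P P q = 0.
  by move=> Uq; rewrite (conn0_P oU sP Uq) P_unit scaleN1r subrr scaler0.
rewrite (conn0_zero_r oU sX Up z) conn0_P_XP// (conn0_P oU bracket_XP_smooth Up).
rewrite bracket_XP_orth// bracket_XP//.
by apply/rowP => i; rewrite !mxE; field.
Qed.

End Orthogonal.
End TorseForming.

Theorem theorem4p4 (R : realType) (n : nat) (n_ge3 : (3 <= n)%N)
    (M : manifold R n) (g : metric M) (g_GRW : GRW g)
    (D : vfield M -> vfield M -> vfield M)
    (D_LC : levi_civita g D)
    (P : vfield M) (P_smooth : smooth_vf setT P)
    (P_unit : forall p : M, inner g P P p = -1)
    (P_conn : parallel (conn1 g D P) P) :
  [/\ ~ tensor_zero (curv0 (conn0 g D P)),
      ~ tensor_zero (curv4 (conn1 g D P) (conn2 g D P))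
    & ~ tensor_zero (curv5 (conn1 g D P) (conn2 g D P))].
Proof.
have [g_lor _] := g_GRW; have [p _] := manifold_nonempty M.
set c := chart_at p; pose U := chart_dom c.
have oU : open U := chart_dom_open c.
have Up : U p := chart_at_dom p.
(* v + g(v, P) P is the component of v orthogonal to P *)
have [v vP] := exists_not_multiple (g p) (P p) (ltnW n_ge3).
pose E := coord_field c v.
have sE : smooth_vf U E := coord_field_smooth v (chart_at_atlas p).
have sP := smooth_P P_smooth U.
(* D E P = E + pi(E) P is the projection of E orthogonally to P *)
pose X := D E P.
have sX : smooth_vf U X := conn_smooth (lc_connection D_LC) oU sE sP.
have XE q (Uq : U q) := nabla_P P_unit P_conn oU sE Uq.
have X_orth q : U q -> inner g X P q = 0.
  move=> Uq; rewrite /inner /X XE// bilinDl bilinZl -/(inner g E P q).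
  by rewrite -/(inner g P P q) P_unit mulrN1 subrr.
have Xp : X p != 0 by rewrite /X XE// /inner /E coord_field_at.
have nz (a : R) : a != 0 -> a *: X p = 0 -> False.
  by move=> a0 /eqP; rewrite scaler_eq0 (negPf a0) (negPf Xp).
split=> T0.
- apply: (nz (- 4^-1)); first by rewrite oppr_eq0 invr_eq0 pnatr_eq0.
  rewrite -(curv0_XPP g_lor D_LC P_smooth P_unit P_conn oU sX X_orth Up).
  exact: (T0 U).
- apply: (nz (- 1)); first by rewrite oppr_eq0 oner_eq0.
  rewrite scaleN1r -(curv4_XPP g_lor D_LC P_smooth P_unit P_conn oU sX X_orth Up).
  exact: (T0 U).
apply: (nz (- 2^-1)); first by rewrite oppr_eq0 invr_eq0 pnatr_eq0.
rewrite -(curv5_XPP g_lor D_LC P_smooth P_unit P_conn oU sX X_orth Up).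
exact: (T0 U).
Qed.
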